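(* Let $(p_n)_{n\in\omega}$ be the hitting probabilities of the random online functions. If $x\in 2^\omega$ is in the range of some random online function, then there is $c\in\omega$ such that for all $n$, \[ K(x\upharpoonright n)\geq -\log p_n-c . \] In particular, $x$ is complex.
   Context: $2^{<\omega}$ is the set of finite binary strings, $\epsilon$ the empty string, $y\upharpoonright n=(y(0),\dots,y(n-1))$, and $[\![\sigma]\!]=\{x\in 2^\omega:\sigma\prec x\}$. Let $\sigma_0=\epsilon,\sigma_1,\sigma_2,\dots$ list $2^{<\omega}$ in length-lexicographic order. Each $z\in 2^\omega$ codes the representing function $f_z:2^{<\omega}\setminus\{\epsilon\}\to\{0,1\}$, $f_z(\sigma_{n+1})=z(n)$, and the online function $F_z:2^\omega\to 2^\omega$, $F_z(y)(n)=f_z(y\upharpoonright (n+1))$. A random online function is an $F_z$ with $z$ Martin-Löf random with respect to the uniform measure on $2^\omega$. Hitting probabilities: $p_n$ is the probability (uniform measure of the set of codes $z\in 2^\omega$) that $\mathrm{ran}(F_z)\cap[\![\sigma]\!]\neq\emptyset$, for a fixed $\sigma$ of length $n$ (the value depends only on $n$). These satisfy $p_0=1$, $p_1=3/4$ and $p_{n+1}=p_n(1-\tfrac14 p_n)$. $K$ denotes prefix-free Kolmogorov complexity and $\log$ is base $2$. An order function is a non-decreasing unbounded function $g:\omega\to\omega$. A real $x\in 2^\omega$ is complex if there is a computable order function $g$ with $K(x\upharpoonright n)\ge g(n)$ for every $n$. *)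

(* Defs.v *)
From HB Require Import structures.
From mathcomp Require Import all_boot all_order all_algebra.
From mathcomp Require Import all_classical all_reals all_analysis.
From mathcomp Require Import zify lra.
Set Implicit Arguments.
Unset Strict Implicit.
Unset Printing Implicit Defensive.
Import Order.TTheory GRing.Theory Num.Theory.
Local Open Scope classical_set_scope.
Local Open Scope ring_scope.

Notation str := (seq bool).

(* The rank of s in the length-lexicographic order: "1s" read in binary,
   minus one, so that [strank (s_n) = n] for the listing s_0 = [::], s_1, ...
   See [strank_bij] and [strank_llex]. *)
Definition bin (a : nat) (s : str) : nat :=
  foldl (fun m (b : bool) => b + m.*2)%N a s.
Definition strank (s : str) : nat := (bin 1 s).-1.

Lemma bin_rcons a s b : bin a (rcons s b) = (b + (bin a s).*2)%N.
Proof. by rewrite /bin foldl_rcons. Qed.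

Lemma bin_gt0 s : (0 < bin 1 s)%N.
Proof.
elim/last_ind: s => // s b IH.
by rewrite bin_rcons; apply: ltn_addl; rewrite double_gt0.
Qed.

Lemma binE a s : bin a s = (a * 2 ^ size s + bin 0 s)%N.
Proof.
elim/last_ind: s => [|s b IH]; first by rewrite /bin /= muln1 addn0.
by rewrite !bin_rcons size_rcons expnS IH; move: (2 ^ size s)%N => m; lia.
Qed.

Lemma bin_lt s : (bin 0 s < 2 ^ size s)%N.
Proof.
elim/last_ind: s => // s b IH.
by rewrite bin_rcons size_rcons expnS; move: (2 ^ size s)%N IH => m; lia.
Qed.

Lemma strank_inj : injective strank.
Proof.
move=> s t /(congr1 succn); rewrite /strank !prednK ?bin_gt0 //.
elim/last_ind: s t => [|s b IH] t; case/lastP: t => [|t c] //.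
- rewrite bin_rcons; have := bin_gt0 t.
  by case: (bin 1 t) => // m _; rewrite doubleS /bin /= !addnS.
- rewrite bin_rcons; have := bin_gt0 s.
  by case: (bin 1 s) => // m _; rewrite doubleS /bin /= !addnS.
rewrite !bin_rcons => e; have /(congr1 half) := e.
rewrite !half_bit_double => /IH <-; congr rcons.
by move: (congr1 odd e); rewrite !oddD !odd_double !addbF !oddb.
Qed.

Lemma strank_surj n : exists s, strank s = n.
Proof.
have [m] := ubnP n; elim: m n => // m IH [|n] lt_nm; first by exists [::].
have /IH [s Es] : (n./2 < m)%N.
  by lia.
exists (rcons s (odd n.+2)).
rewrite /strank bin_rcons -[bin 1 s]prednK ?bin_gt0 // -/(strank s) Es.
by rewrite doubleS !addnS /= negbK odd_double_half.
Qed.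

Lemma strank_bij : bijective strank.
Proof.
pose g n := xget [::] [set s | strank s = n].
have gK : cancel g strank.
  by move=> n; exact: xgetPex (strank_surj n).
by exists g => // s; apply: strank_inj; rewrite gK.
Qed.

Lemma strank_llex s t :
  (strank s < strank t)%N =
  (size s < size t)%N
  || (size s == size t) && ((s : seqlexi bool) < (t : seqlexi bool))%O.
Proof.
have E u : strank u = (2 ^ size u + bin 0 u).-1 by rewrite /strank binE mul1n.
have := bin_lt s; have := bin_lt t; have := bin_gt0 s; have := bin_gt0 t.
rewrite !E ![bin 1 _]binE !mul1n.
case: (ltngtP (size s) (size t)) => [lt_st|lt_ts|eq_st] /=.
- by have := leq_pexp2l (isT : (0 < 2)%N) lt_st; rewrite expnS; lia.
- by have := leq_pexp2l (isT : (0 < 2)%N) lt_ts; rewrite expnS; lia.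
rewrite eq_st => gt_t gt_s lt_t lt_s.
have -> : ((2 ^ size t + bin 0 s).-1 < (2 ^ size t + bin 0 t).-1)%N =
  (bin 0 s < bin 0 t)%N by lia.
elim: s t eq_st {gt_t gt_s lt_t lt_s} => [|b s IH] [|c t] // [eq_st].
rewrite ltxi_cons -(IH t eq_st).
have binc d u : bin 0 (d :: u) = (d * 2 ^ size u + bin 0 u)%N.
  by rewrite -binE /bin /= addn0.
rewrite !binc eq_st.
have := bin_lt s; have := bin_lt t; rewrite eq_st.
by case: b; case: c => /=; lia.
Qed.

Definition initseg (x : nat -> bool) (n : nat) : str := mkseq x n.

Definition cylinder (s : str) : set (nat -> bool) :=
  [set x | initseg x (size s) = s].

Definition cantor : measurableType (range cylinder).-sigma :=
  g_sigma_algebraType (range cylinder).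

Definition digits (R : realType) (t : R) : cantor :=
  fun n => odd (Num.truncn (t * 2 ^+ n.+1)).

Lemma initsegS x n : initseg x n.+1 = rcons (initseg x n) (x n).
Proof. exact: mkseqS. Qed.

Lemma cylinder0 : cylinder [::] = setT.
Proof. by apply/seteqP; split. Qed.

Lemma cylinder_rcons s b :
  cylinder (rcons s b) = cylinder s `&` [set x | x (size s) = b].
Proof.
apply/seteqP; split => x; rewrite /cylinder /= size_rcons initsegS.
  by move=> /rcons_inj [-> ->].
by move=> [-> ->].
Qed.

Lemma measurable_cylinder s : measurable (cylinder s : set cantor).
Proof. by apply: sub_sigma_algebra; exists s. Qed.

Lemma truncn_preimage (R : realType) (m k : nat) : (0 < k)%N ->
  [set t : R | Num.truncn (t * 2 ^+ m) = k] =
  `[k%:R / 2 ^+ m, k.+1%:R / 2 ^+ m[%classic.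
Proof.
move=> k0; have m0 : 0 < 2 ^+ m :> R by rewrite exprn_gt0.
apply/seteqP; split => t /=; rewrite in_itv /= ler_pdivrMr // ltr_pdivlMr //.
  move=> e; move: k0; rewrite -e truncn_gt0 => t1.
  by apply: truncn_itv; exact: le_trans t1.
by move=> tk; apply: truncn_def.
Qed.

Lemma measurable_digits (R : realType) :
  measurable_fun setT (@digits R : R -> cantor).
Proof.
have mtrue n : measurable [set t : R | digits t n = true].
  rewrite (_ : [set t | _] = \bigcup_(k in [set k | odd k])
    [set t : R | Num.truncn (t * 2 ^+ n.+1) = k]); last first.
    apply/seteqP; split => t /=; first by move=> ?; eexists; last reflexivity.
    by move=> [k /= ok e]; rewrite /digits e.
  apply: bigcup_measurable => -[//|k] _.
  by rewrite truncn_preimage //; exact: measurable_itv.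
have mbit n b : measurable [set t : R | digits t n = b].
  case: b => //; rewrite (_ : [set t | _] = ~` [set t : R | digits t n = true]).
    exact: measurableC.
  by apply/seteqP; split => t /=; case: (digits t n).
apply: (@measurability _ _ R cantor setT (@digits R) (range cylinder)) => //.
move=> _ [_ [s _ <-] <-]; rewrite setTI; elim/last_ind: s => [|s b IH].
  by rewrite cylinder0 preimage_setT.
by rewrite cylinder_rcons preimage_setI; apply: measurableI => //; exact: mbit.
Qed.

Definition digits_mfun (R : realType) : {mfun measurableTypeR R >-> cantor} :=
  HB.pack (@digits R : measurableTypeR R -> cantor)
    (@isMeasurableFun.Build _ _ (measurableTypeR R) cantor (@digits R)
       (@measurable_digits R)).

(* The uniform measure is realised as the law of the binary digits of a
   uniform random number in [0, 1]; it is the unique probability measure on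
   [cantor] satisfying [uniform_cylinder]. *)
Definition uniform (R : realType) : probability cantor R :=
  distribution (uniform_prob (@ltr01 R)) (digits_mfun R).

Lemma digits_cylinder (R : realType) (t : R) s : 0 <= t < 1 ->
  cylinder s (digits t) <-> Num.truncn (t * 2 ^+ size s) = bin 0 s.
Proof.
move=> /andP[t0 t1]; elim/last_ind: s => [|s b IH].
  rewrite cylinder0 /= expr0 mulr1; split=> // _.
  by apply: truncn_def; rewrite t0 t1.
have half_trunc : (Num.truncn (t * 2 ^+ (size s).+1))./2 =
    Num.truncn (t * 2 ^+ size s).
  apply/esym/truncn_def.
  have := @truncn_itv _ (t * 2 ^+ (size s).+1).
  rewrite mulr_ge0 ?exprn_ge0 // => /(_ isT).
  move: (Num.truncn _) => k; rewrite exprS mulrCA => /andP[kl ku].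
  have := odd_double_half k; move: (odd k) (k./2) => c h hk.
  move: kl ku; rewrite -hk -addn1 -!muln2 !natrD !natrM => kl ku.
  rewrite -[h.+1]addn1 natrD.
  case: c {hk} kl ku => /= kl ku; apply/andP; split; lra.
rewrite cylinder_rcons bin_rcons size_rcons /=; split.
  by move=> [/IH <-]; rewrite /digits -half_trunc => <-; rewrite odd_double_half.
move=> e; split.
  by apply/IH; rewrite -half_trunc e half_bit_double.
by rewrite /digits e oddD odd_double addbF oddb.
Qed.

Lemma uniform_cylinder (R : realType) s :
  uniform R (cylinder s) = (2 ^- size s)%:E.
Proof.
rewrite /= /distribution /pushforward /uniform_prob.
set A := _ @^-1` _.
have mA : measurable A.
  rewrite -[A]setTI; apply: measurable_digits => //; exact: measurable_cylinder.
rewrite integral_uniform_pdf.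
rewrite (eq_integral (cst 1%E)); last first.
  move=> t; rewrite inE /uniform_pdf => -[_ /=].
  by rewrite in_itv /= subr0 => ->; rewrite invr1.
rewrite integral_cst ?mul1e; last exact: measurableI.
have -> : A `&` `[0, 1] =
    `[(bin 0 s)%:R / 2 ^+ size s, (bin 0 s).+1%:R / 2 ^+ size s[%classic
    `|` (A `&` [set 1]).
  have p0 : 0 < 2 ^+ size s :> R by rewrite exprn_gt0.
  apply/seteqP; split => t /=.
    rewrite in_itv /= => -[At /andP[t0]]; rewrite le_eqVlt => /orP[/eqP t1|t1].
      by right.
    left; have /digits_cylinder : 0 <= t < 1 by rewrite t0.
    move=> /(_ s) [/(_ At) <- _].
    rewrite in_itv /= ler_pdivrMr // ltr_pdivlMr //; apply: truncn_itv.
    by rewrite mulr_ge0 // ltW.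
  case=> [|[At e]]; last by split=> //; rewrite e in_itv /= ler01 lexx.
  rewrite in_itv /= ler_pdivrMr // ltr_pdivlMr // => ts.
  have t0 : 0 <= t.
    by move: ts => /andP[+ _]; rewrite -(pmulr_lge0 _ p0); apply: le_trans.
  have t1 : t < 1.
    rewrite -(ltr_pM2r p0) mul1r; move: ts => /andP[_ /lt_le_trans]; apply.
    by rewrite -natrX ler_nat bin_lt.
  split; last by rewrite in_itv /= t0 ltW.
  by apply/digits_cylinder; [rewrite t0|exact: truncn_def].
have m1 : measurable (A `&` [set 1]) by exact: measurableI.
have m10 : lebesgue_measure (A `&` [set 1]) = 0%E.
  by apply: (subset_measure0 m1 _ (@subIsetr _ _ _)) (lebesgue_measure_set1 _).
rewrite measureU0 //.
apply: etrans (lebesgue_measure_itv `[_, _[) _.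
rewrite /= lte_fin ltr_pM2r ?invr_gt0 ?exprn_gt0 //.
by rewrite ltr_nat ltnSn -EFinD -mulrBl -natrB // subSnn mul1r.
Qed.

Lemma cylinderI s t : (size s <= size t)%N ->
  cylinder s `&` cylinder t = set0 \/ cylinder s `&` cylinder t = cylinder t.
Proof.
elim/last_ind: t => [|t b IH].
  by rewrite leqn0 => /nilP ->; right; rewrite cylinder0 setTI.
rewrite size_rcons leq_eqVlt => /orP[/eqP e|/IH].
  have [->|st] := eqVneq s (rcons t b); first by right; rewrite setIid.
  left; apply/seteqP; split => // x [xs xt]; apply: (negP st); apply/eqP.
  by rewrite -xs -[RHS]xt e size_rcons.
rewrite cylinder_rcons setIA => -[]->; last by right.
by left; rewrite set0I.
Qed.

Lemma uniform_unique (R : realType) (mu : {measure set cantor -> \bar R}) :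
  (forall s, mu (cylinder s) = (2 ^- size s)%:E) ->
  forall A, measurable A -> mu A = uniform R A.
Proof.
move=> mu_cyl A mA.
pose G := [set X | X = set0 \/ exists s, X = cylinder s].
have Gm : G `<=` @measurable _ cantor.
  by move=> _ [->|[s ->]]; [exact: measurable0|exact: measurable_cylinder].
have GI : setI_closed G.
  move=> _ B [->|[s ->]]; first by move=> _; left; rewrite set0I.
  case=> [->|[t ->]]; first by left; rewrite setI0.
  case: (leqP (size s) (size t)) => [|/ltnW] /cylinderI st.
    by case: st => ->; [left|right; exists t].
  by rewrite setIC; case: st => ->; [left|right; exists s].
have GT : G setT by right; exists [::]; rewrite cylinder0.
have TT : \bigcup_(k : nat) [set: cantor] = setT.
  by apply: bigcup_const; exists 0%N.
have GA : <<s G >> A.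
  apply: (smallest_sub (smallest_sigma_algebra setT G) _ mA) => _ [s _ <-].
  by apply: sub_sigma_algebra; right; exists s.
apply: (@g_sigma_algebra_measure_unique _ R cantor G Gm _ (fun=> GT) TT
  mu (uniform R) GI _ _ A GA) => [_ [->|[s ->]]|_].
- by rewrite !measure0.
- by rewrite mu_cyl; exact/esym/uniform_cylinder.
- by rewrite -cylinder0 mu_cyl ltry.
Qed.

(* f_z (s_(n+1)) = z n; the value at [::] is never used. *)
Definition representing (z : cantor) (s : str) : bool := z (strank s).-1.

Definition online (z y : cantor) : cantor :=
  fun n => representing z (initseg y n.+1).

Definition hits (s : str) : set cantor :=
  [set z | range (online z) `&` cylinder s !=set0].

(* The probability that [range (online z)] meets the cylinder of a string of
   length n; by [hits_size] the choice of the string is immaterial. *)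
Definition hitting_prob (R : realType) (n : nat) : R :=
  fine (uniform R (hits (nseq n false))).

Lemma nth_initseg x n i : (i < n)%N -> nth false (initseg x n) i = x i.
Proof. exact: nth_mkseq. Qed.

Lemma cylinderP s (x : cantor) :
  cylinder s x <-> forall i, (i < size s)%N -> x i = nth false s i.
Proof.
split=> [<- i|xs]; first by rewrite size_mkseq => /nth_initseg ->.
apply: (@eq_from_nth _ false); rewrite size_mkseq // => i ltis.
by rewrite nth_initseg // xs.
Qed.

Lemma measurable_hits s : measurable (hits s).
Proof.
pose F t := if `[< cylinder t `<=` hits s >] then cylinder t else set0.
have -> : hits s = \bigcup_t F t; last first.
  apply: countable_bigcupT_measurable => // t; rewrite /F.
  by case: ifP => _; [exact: measurable_cylinder|exact: measurable0].
apply/seteqP; split => z; last first.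
  by move=> [t _]; rewrite /F; case: ifP => // /asboolP; apply.
move=> [_ [[y _ <-] Fs]].
pose N := (\max_(i < size s) strank (initseg y i.+1)).+1.
have zN : cylinder (initseg z N) `<=` hits s.
  move=> z' /cylinderP; rewrite size_mkseq => z'z.
  exists (online z' y); split; first by exists y.
  apply/cylinderP => i ltis; move/cylinderP: Fs => /(_ i ltis) <-.
  have ltN : ((strank (initseg y i.+1)).-1 < N)%N.
    rewrite ltnS (leq_trans (leq_pred _)) //.
    exact: (@leq_bigmax _ (fun i : 'I_(size s) => strank (initseg y i.+1))
      (Ordinal ltis)).
  by rewrite /online /representing z'z // nth_initseg.
exists (initseg z N) => //; rewrite /F; case: ifP => [_|/asboolP //].
by apply/cylinderP => i; rewrite size_mkseq => /nth_initseg ->.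
Qed.

Definition flip (a : nat -> bool) (z : cantor) : cantor := fun n => z n (+) a n.

Lemma flip_cylinder a s :
  flip a @^-1` cylinder s =
  cylinder (mkseq (fun i => nth false s i (+) a i) (size s)).
Proof.
apply/seteqP; split => z /cylinderP zs; apply/cylinderP.
  move=> i; rewrite size_mkseq => ltis; rewrite nth_mkseq // -zs //.
  by rewrite /flip addbK.
move=> i ltis; rewrite /flip zs ?size_mkseq // nth_mkseq //.
by rewrite addbK.
Qed.

Lemma measurable_flip a : measurable_fun setT (flip a).
Proof.
apply: (@measurability _ _ cantor cantor setT _ (range cylinder)) => //.
move=> _ [_ [s _ <-] <-].
by rewrite setTI flip_cylinder; exact: measurable_cylinder.
Qed.

Definition flip_mfun a : {mfun cantor >-> cantor} :=
  HB.pack (flip a) (@isMeasurableFun.Build _ _ cantor cantor (flip a)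
    (@measurable_flip a)).

Lemma uniform_flip (R : realType) a (A : set cantor) : measurable A ->
  uniform R (flip a @^-1` A) = uniform R A.
Proof.
move=> mA.
apply: (uniform_unique (mu := distribution (uniform R) (flip_mfun a))) => // s.
apply: etrans (congr1 (uniform R) (flip_cylinder a s)) _.
by rewrite uniform_cylinder size_mkseq.
Qed.

Lemma hits_size (R : realType) s :
  uniform R (hits s) = (hitting_prob R (size s))%:E.
Proof.
rewrite /hitting_prob fineK; last exact: fin_num_measure (measurable_hits _).
have [g _ gK] := strank_bij.
pose a n := nth false s (size (g n.+1)).-1.
rewrite -(uniform_flip R a (measurable_hits (nseq _ false))).
congr (uniform R _).
have onl z y i : online (flip a z) y i = online z y i (+) nth false s i.
  rewrite /online /representing /flip; congr (_ (+) _); rewrite /a prednK.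
    have [h hK _] := strank_bij.
    have -> : g (strank (initseg y i.+1)) = initseg y i.+1.
      by apply: strank_inj; rewrite gK.
    by rewrite size_mkseq.
  by rewrite lt0n; apply/eqP => e; have := @strank_inj _ [::] e.
apply/seteqP; split => z [_ [[y _ <-] /cylinderP Fs]].
  exists (online (flip a z) y); split; first by exists y.
  apply/cylinderP => i; rewrite size_nseq => ltis.
  by rewrite onl Fs // addbb nth_nseq ltis.
exists (online z y); split; first by exists y.
apply/cylinderP => i ltis; have := Fs i.
rewrite size_nseq onl nth_nseq ltis => /(_ isT).
by case: (online z y i); case: (nth false s i).
Qed.

(* Codes for Kleene's mu-recursive functions. *)
Inductive recfun : Type :=
| Zero
| Succ
| Proj of nat
| Comp of recfun & seq recfun
| Prec of recfun & recfun
| Mu of recfun.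

(* [computes c v y]: the partial function of code c is defined at the
   arguments v, with value y.  Arities are not tracked in the syntax: an
   argument missing from v is read as 0.  [Prec f g] recurses on the first
   argument; [Mu f] searches for its first argument, all earlier values of f
   being required to be defined and nonzero. *)
Fixpoint computes (c : recfun) : seq nat -> nat -> Prop :=
  match c with
  | Zero => fun _ y => y = 0%N
  | Succ => fun v y => y = (nth 0%N v 0).+1
  | Proj i => fun v y => y = nth 0%N v i
  | Comp f gs => fun v y =>
      exists2 w : seq nat,
        (fix args (gs : seq recfun) (w : seq nat) : Prop :=
           match gs, w with
           | [::], [::] => True
           | g :: gs', z :: w' => computes g v z /\ args gs' w'
           | _, _ => False
           end) gs w
        & computes f w y
  | Prec f g => fun v =>
      (fix rec (n : nat) : nat -> Prop :=
         match n with
         | 0 => computes f (behead v)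
         | m.+1 => fun y =>
             exists2 r, rec m r & computes g [:: m, r & behead v] y
         end) (head 0%N v)
  | Mu f => fun v y =>
      computes f (y :: v) 0%N /\
      forall k, (k < y)%N -> exists m, computes f (k :: v) m.+1
  end.

Lemma recfun_nested_ind (P : recfun -> Prop) :
  P Zero -> P Succ -> (forall i, P (Proj i)) ->
  (forall f gs, P f -> (forall i, P (nth Zero gs i)) -> P (Comp f gs)) ->
  (forall f g, P f -> P g -> P (Prec f g)) -> (forall f, P f -> P (Mu f)) ->
  forall c, P c.
Proof.
move=> P0 PS Pp PC PR PM; fix rec 1; case=> [||i|f gs|f g|f].
- exact: P0.
- exact: PS.
- exact: Pp.
- apply: PC; first exact: rec f.
  elim: gs => [|g gs IH] [|i] /=.
  + exact: P0.
  + exact: P0.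
  + exact: rec g.
  + exact: IH i.
- apply: PR; [exact: rec f|exact: rec g].
- apply: PM; exact: rec f.
Qed.

Lemma computes_fun c v y y' : computes c v y -> computes c v y' -> y = y'.
Proof.
elim/recfun_nested_ind: c v y y' =>
    [||i|f gs IHf IHgs|f g IHf IHg|f IHf] v y y' /=.
- by move=> -> ->.
- by move=> -> ->.
- by move=> -> ->.
- move=> [w gw fw] [w' gw' fw']; suff e : w = w'.
    by rewrite -e in fw'; exact: IHf fw fw'.
  elim: gs w w' gw gw' IHgs {fw fw'} => [|g gs IH] [|z w] [|z' w'] //=.
  move=> [gz gw] [gz' gw'] IHgs; rewrite (IHgs 0%N _ _ _ gz gz').
  by rewrite (IH w w' gw gw') // => i; exact: (IHgs i.+1).
- elim: (head _ _) y y' => [|n IH] y y'; first exact: IHf.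
  move=> [r nr gr] [r' nr' gr']; rewrite (IH _ _ nr' nr) in gr'.
  exact: IHg gr gr'.
move=> [f0 fS] [f0' fS']; case: (ltngtP y y') => // lt.
  by have [m fm] := fS' _ lt; have := IHf _ _ _ f0 fm.
by have [m fm] := fS _ lt; have := IHf _ _ _ f0' fm.
Qed.

Definition computable (g : nat -> nat) : Prop :=
  exists c, forall n, computes c [:: n] (g n).

(* Strings are represented by their rank in the length-lexicographic listing. *)
Definition partial_computable (M : str -> option str) : Prop :=
  exists c, forall s y,
    computes c [:: strank s] y <-> exists2 t, M s = Some t & y = strank t.

Definition uniformly_ce (W : nat -> set str) : Prop :=
  exists c, forall n s, W n s <-> exists y, computes c [:: n; strank s] y.

Definition prefix_free_machine (M : str -> option str) : Prop :=
  partial_computable M /\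
  forall s t, M s <> None -> M t <> None -> seq.prefix s t -> s = t.

Definition optimal_machine (U : str -> option str) : Prop :=
  prefix_free_machine U /\
  forall M, prefix_free_machine M -> exists d : nat, forall s t,
    M s = Some t -> exists2 s', U s' = Some t & (size s' <= size s + d)%N.

(* K depends on the choice of the optimal machine U only up to an additive
   constant.  The infimum is a minimum: every string has a U-description. *)
Definition K (R : realType) (U : str -> option str) (t : str) : \bar R :=
  ereal_inf [set ((size s)%:R)%:E | s in [set s | U s = Some t]].

Definition order_function (g : nat -> nat) : Prop :=
  {homo g : m n / (m <= n)%N} /\ forall k, exists n, (k <= g n)%N.

Definition complex (R : realType) (U : str -> option str) (x : cantor) : Prop :=
  exists g, [/\ computable g, order_function g &
    forall n, (((g n)%:R)%:E <= K R U (initseg x n))%E].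

Definition open_of (A : set str) : set cantor := \bigcup_(s in A) cylinder s.

Definition ml_test (R : realType) (W : nat -> set str) : Prop :=
  uniformly_ce W /\
  forall n, (uniform R (open_of (W n)) <= (2 ^- n)%:E)%E.

Definition ml_random (R : realType) (z : cantor) : Prop :=
  forall W, ml_test R W -> ~ (\bigcap_n open_of (W n)) z.

Definition log2 (R : realType) (a : R) : R := ln a / ln 2.

(* Main.v *)
(* Suppose x = F_z(y), and consider all s with U(s) = r and
   2^(|s| + c + 2) <= |r| + 1.  The codes hitting such an r have measure
   p_|r| <= 4 / (|r| + 4) <= 2^-c 2^-|s|, so by Kraft's inequality for the
   prefix-free domain of U the union over s has measure at most 2^-c: as c
   varies this is a Martin-Loef test.  A random z escapes it for some c, hence
   n + 1 < 2^(|s| + c + 2) for every description s of an initial segment of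
   length n of x.  Both conclusions follow, since the recursion
   p_(n+1) = p_n (1 - p_n / 4) gives 1 / (n + 1) <= p_n <= 4 / (n + 4). *)
From HB Require Import structures.
Require Import Defs.
From mathcomp Require Import all_boot all_order all_algebra.
From mathcomp Require Import all_classical all_reals all_analysis.
From mathcomp Require Import zify lra.
Local Open Scope classical_set_scope.
Local Open Scope ring_scope.
Import Order.TTheory GRing.Theory Num.Theory.

(** * Computable total functions *)

(** Expressions take the whole argument list, as arities are untracked: the closure lemmas then
    build programs pointwise over one shared list of variables. *)
Definition total_computable (e : seq nat -> nat) : Prop :=
  exists c, forall v, computes c v (e v).

Lemma tc_ext e e' : e =1 e' -> total_computable e -> total_computable e'.
Proof. by move=> ee [c ce]; exists c => v; rewrite -ee. Qed.

Lemma tc_proj i : total_computable (fun v => nth 0%N v i).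
Proof. by exists (Proj i). Qed.

Lemma tc_app1 f e : total_computable (fun v => f (nth 0%N v 0)) ->
  total_computable e -> total_computable (fun v => f (e v)).
Proof.
by move=> [c fc] [d ed]; exists (Comp c [:: d]) => v; exists [:: e v] => //=.
Qed.

Lemma tc_succ e : total_computable e -> total_computable (fun v => (e v).+1).
Proof. by apply: (@tc_app1 succn); exists Succ. Qed.

Lemma tc_const k : total_computable (fun=> k).
Proof. by elim: k => [|k IH]; [exists Zero|exact: (tc_succ _ IH)]. Qed.

(** Primitive recursion whose step applies the program of [f] to entry 1, the previous value, since
    entry 0 is the counter. Addition, subtraction and powers of 2 are such iterations. *)
Lemma tc_iter f n e : total_computable (fun v => f (nth 0%N v 0)) ->
  total_computable n -> total_computable e ->
  total_computable (fun v => iter (n v) f (e v)).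
Proof.
move=> [c fc] [d nd] [b eb].
exists (Comp (Prec (Proj 0) (Comp c [:: Proj 1])) [:: d; b]) => v.
exists [:: n v; e v] => //=; elim: (n v) => // m IH.
by exists (iter m f (e v)) => //=; exists [:: iter m f (e v)].
Qed.

Lemma tc_pred e : total_computable e -> total_computable (fun v => (e v).-1).
Proof.
apply: (@tc_app1 predn); exists (Prec Zero (Proj 0)) => v.
rewrite nth0 /=; elim: (head _ v) => // m IH.
by exists m.-1.
Qed.

Lemma tc_add e1 e2 : total_computable e1 -> total_computable e2 ->
  total_computable (fun v => (e1 v + e2 v)%N).
Proof.
move=> t1 t2; apply: tc_ext (tc_iter succn e2 e1 _ t2 t1).
  by move=> v; rewrite iter_succn.
by apply: tc_succ; exact: tc_proj.
Qed.

Lemma tc_sub e1 e2 : total_computable e1 -> total_computable e2 ->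
  total_computable (fun v => (e1 v - e2 v)%N).
Proof.
move=> t1 t2; apply: tc_ext (tc_iter predn e2 e1 _ t2 t1).
  by move=> v; rewrite iter_predn.
by apply: tc_pred; exact: tc_proj.
Qed.

Lemma tc_double e :
  total_computable e -> total_computable (fun v => (e v).*2).
Proof.
by move=> te; apply: tc_ext (tc_add _ _ te te) => v; rewrite addnn.
Qed.

Lemma tc_exp2 e :
  total_computable e -> total_computable (fun v => (2 ^ e v)%N).
Proof.
move=> te; apply: tc_ext (tc_iter double e (fun=> 1%N) _ te (tc_const 1)).
  move=> v; elim: (e v) => // m IH.
  by rewrite iterS IH expnS mul2n.
by apply: tc_double; exact: tc_proj.
Qed.

Lemma tc_negb (b : seq nat -> bool) :
  total_computable (fun v => b v) -> total_computable (fun v => ~~ b v).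
Proof.
move=> tb; apply: tc_ext (tc_sub _ _ (tc_const 1) tb) => v.
by case: (b v).
Qed.

Lemma tc_and (b1 b2 : seq nat -> bool) :
  total_computable (fun v => b1 v) -> total_computable (fun v => b2 v) ->
  total_computable (fun v => b1 v && b2 v).
Proof.
move=> t1 t2; apply: tc_ext (tc_sub _ _ t1 (tc_negb _ t2)) => v.
by case: (b1 v); case: (b2 v).
Qed.

Lemma tc_leq e1 e2 : total_computable e1 -> total_computable e2 ->
  total_computable (fun v => e1 v <= e2 v)%N.
Proof.
move=> t1 t2; apply: tc_ext (tc_sub _ _ (tc_const 1) (tc_sub _ _ t1 t2)) => v.
by rewrite /leq; case: (e1 v - e2 v)%N.
Qed.

Lemma tc_eq e1 e2 : total_computable e1 -> total_computable e2 ->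
  total_computable (fun v => e1 v == e2 v).
Proof.
move=> t1 t2; apply: tc_ext (tc_and _ _ (tc_leq _ _ t1 t2) (tc_leq _ _ t2 t1)).
by move=> v; rewrite -eqn_leq.
Qed.

Lemma tc_eqb (b1 b2 : seq nat -> bool) :
  total_computable (fun v => b1 v) -> total_computable (fun v => b2 v) ->
  total_computable (fun v => b1 v == b2 v).
Proof.
move=> t1 t2; apply: tc_ext (tc_eq _ _ t1 t2) => v.
by case: (b1 v); case: (b2 v).
Qed.

(** Here [b] is the condition for continuing: [Mu] stops at value 0, that is, where [b] first
    fails. *)
Lemma tc_mu (b : seq nat -> bool) m : total_computable (fun v => b v) ->
  (forall v, ~~ b (m v :: v)) -> (forall v k, (k < m v)%N -> b (k :: v)) ->
  total_computable m.
Proof.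
move=> [c bc] m0 mS; exists (Mu c) => v; split.
  by have := bc (m v :: v); rewrite (negbTE (m0 v)).
by move=> k /mS bk; exists 0%N; have := bc (k :: v); rewrite bk.
Qed.

Lemma tc_half e :
  total_computable e -> total_computable (fun v => (e v)./2).
Proof.
apply: (@tc_app1 half).
apply: (tc_mu (fun v => (nth 0 v 0).*2.+1 < nth 0 v 1)%N) => [|v|v k] /=.
- apply: tc_leq; last exact: tc_proj.
  by do 2 apply: tc_succ; apply: tc_double; exact: tc_proj.
- by rewrite nth0; lia.
- by rewrite nth0; lia.
Qed.

Lemma tc_odd e :
  total_computable e -> total_computable (fun v => odd (e v)).
Proof.
move=> te; apply: tc_ext (tc_sub _ _ te (tc_double _ (tc_half _ te))) => v.
by rewrite -{1}(odd_double_half (e v)) addnK.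
Qed.

Lemma tc_log e :
  total_computable e -> total_computable (fun v => trunc_log 2 (e v)).
Proof.
apply: (@tc_app1 (trunc_log 2)).
apply: (tc_mu (fun v => (2 ^ (nth 0 v 0).+1 <= nth 0 v 1)%N)) => [|v|v k] /=.
- apply: tc_leq; last exact: tc_proj.
  by apply: tc_exp2; apply: tc_succ; exact: tc_proj.
- by rewrite -ltnNge nth0 trunc_log_ltn.
- case: (posnP (nth 0%N v 0)) => [->//|v0] lt_k.
  by apply: leq_trans (trunc_logP (isT : 1 < 2)%N v0); rewrite leq_exp2l.
Qed.

(** Bounded quantification as a search: [m v] is the first index below [n v] where [b] fails, or
    [n v] if there is none, and all instances hold iff [n v <= m v]. The search variable is put in
    front of the arguments, whence [behead]. *)
Lemma tc_all n (b : nat -> seq nat -> bool) : total_computable n ->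
  total_computable (fun v => b (head 0%N v) (behead v)) ->
  total_computable (fun v => n (behead v)) ->
  total_computable (fun v => all (b^~ v) (iota 0 (n v))).
Proof.
move=> tn tb tn'; pose m v := find (fun j => ~~ b j v) (iota 0 (n v)).
have tm : total_computable m.
  apply: (tc_mu (fun v => (head 0%N v < n (behead v))%N &&
    b (head 0%N v) (behead v))) => [|v|v k] /=.
  - apply: tc_and => //; apply: tc_leq => //; apply: tc_succ.
    by apply: tc_ext (tc_proj 0) => v; rewrite nth0.
  - apply/andP => -[lt_m]; apply/negP.
    have /(nth_find 0%N) : has (fun j => ~~ b j v) (iota 0 (n v)).
      by rewrite has_find size_iota.
    by rewrite nth_iota.
  - move=> lt_k; have lt_n : (k < n v)%N.
      by apply: leq_trans lt_k _; rewrite /m -{2}(size_iota 0 (n v)) find_size.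
    by have := before_find 0%N lt_k; rewrite nth_iota // lt_n => /negbFE.
apply: tc_ext (tc_leq _ _ tn tm) => v; congr nat_of_bool.
by rewrite -[all _ _]negbK -has_predC has_find size_iota -leqNgt.
Qed.

(** * Strings as ranks *)

Lemma succ_strank s : (strank s).+1 = bin 1 s.
Proof. by rewrite /strank prednK // Defs.bin_gt0. Qed.

Definition rank_size (r : nat) : nat := trunc_log 2 r.+1.

(** For s of rank [r], [r.+1] is the number written 1s in binary; each halving removes the last bit,
    and the parity shows the last bit that is left. *)
Definition rank_prefix (j r : nat) : nat := iter j half r.+1.

Lemma rank_size_strank s : rank_size (strank s) = size s.
Proof.
rewrite /rank_size succ_strank; apply: trunc_log_eq => //.
by rewrite Defs.binE mul1n expnS; have := bin_lt s; lia.
Qed.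

Lemma rank_prefix_strank s i : (i <= size s)%N ->
  rank_prefix (size s - i) (strank s) = bin 1 (take i s).
Proof.
rewrite /rank_prefix succ_strank; elim/last_ind: s => [|s b IH].
  by rewrite leqn0 => /eqP ->.
rewrite size_rcons leq_eqVlt => /orP[/eqP ->|].
  by rewrite subnn take_oversize // size_rcons.
rewrite ltnS => le_i; rewrite subSn // iterSr bin_rcons half_bit_double.
by rewrite IH // -cats1 takel_cat.
Qed.

Lemma odd_rank_prefix s i : (i < size s)%N ->
  odd (rank_prefix (size s - i.+1) (strank s)) = nth false s i.
Proof.
move=> lt_i; rewrite rank_prefix_strank // (take_nth false) // bin_rcons.
by rewrite oddD odd_double addbF oddb.
Qed.

Lemma bin_take i s : (bin 1 (take i s) <= bin 1 s)%N.
Proof.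
have [le_s|/ltnW le_i] := leqP (size s) i; first by rewrite take_oversize.
rewrite -rank_prefix_strank // /rank_prefix succ_strank.
by elim: (size s - i)%N => // j IH; rewrite iterS; lia.
Qed.

Lemma strank_gt0 s : (0 < size s)%N -> (0 < strank s)%N.
Proof.
move=> s0; rewrite -ltnS succ_strank Defs.binE mul1n.
by rewrite ltn_addr // -{1}(expn0 2) ltn_exp2l.
Qed.

(* The code prefix t already sends the input prefix y to s. *)
Definition sends (t y s : str) : bool :=
  [&& size y == size s, strank y <= size t &
   all (fun i => nth false t (strank (take i.+1 y)).-1 == nth false s i)
     (iota 0 (size s))]%N.

(** Arithmetic form of [sends]. Halving strips bits from the end, so [j] counts positions backwards.
    The cell of t that is read has index [rank_prefix j ry] minus 2, and
    [(rank_size rt).+1 - rank_prefix j ry] bits of t follow it. *)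
Definition sends_rank (rt ry rs : nat) : bool :=
  [&& rank_size ry == rank_size rs, ry <= rank_size rt &
   all (fun j => odd (rank_prefix ((rank_size rt).+1 - rank_prefix j ry) rt)
                 == odd (rank_prefix j rs)) (iota 0 (rank_size rs))]%N.

Lemma sends_rankE t y s :
  sends_rank (strank t) (strank y) (strank s) = sends t y s.
Proof.
rewrite /sends_rank /sends !rank_size_strank.
case: eqP => //= eys; case: leqP => //= le_t.
have cell i : (i < size s)%N ->
    (odd (rank_prefix ((size t).+1 - rank_prefix (size s - i.+1) (strank y))
            (strank t)) == odd (rank_prefix (size s - i.+1) (strank s))) =
    (nth false t (strank (take i.+1 y)).-1 == nth false s i).
  move=> lt_i; rewrite odd_rank_prefix // -eys rank_prefix_strank ?eys //.
  have t0 : (0 < strank (take i.+1 y))%N.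
    by apply: strank_gt0; rewrite size_takel ?eys.
  have := bin_take i.+1 y; rewrite -!succ_strank ltnS subSS => le_y.
  congr (_ == _).
  rewrite -odd_rank_prefix; last by lia.
  by congr (odd (rank_prefix _ _)); lia.
apply/allP/allP => H i; rewrite mem_iota add0n /= => lt_i.
  by rewrite -cell //; apply: H; rewrite mem_iota; lia.
(* Counting from the other end is an involution on positions. *)
have -> : i = (size s - (size s - i.+1).+1)%N by lia.
by rewrite cell; [apply: H; rewrite mem_iota|]; lia.
Qed.

(** Prefixes of [y] have no larger rank than [y], so every cell read along [y] has index below
    [strank y] and is fixed by [t]. The input used is [y] followed by zeros. *)
Lemma sends_hits t y s : sends t y s -> cylinder t `<=` hits s.
Proof.
move=> /and3P[/eqP eys le_t /allP ts] z /cylinderP zt.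
exists (online z (fun i => nth false y i)); split; first by eexists.
apply/cylinderP => i lt_i; rewrite /online /representing.
have -> : initseg (fun i => nth false y i) i.+1 = take i.+1 y.
  by rewrite /initseg /mkseq map_nth_iota0 // eys.
have t0 : (0 < strank (take i.+1 y))%N.
  by apply: strank_gt0; rewrite size_takel ?eys.
have := bin_take i.+1 y; rewrite -!succ_strank ltnS => le_y.
rewrite zt; last by lia.
by apply/eqP/ts; rewrite mem_iota.
Qed.

Lemma sends_initseg (z y : cantor) n L : (strank (initseg y n) <= L)%N ->
  sends (initseg z L) (initseg y n) (initseg (online z y) n).
Proof.
move=> le_L; rewrite /sends !size_mkseq eqxx le_L /=.
apply/allP => i; rewrite mem_iota add0n /= => lt_i.
have ti : take i.+1 (initseg y n) = initseg y i.+1.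
  by rewrite /initseg -map_take take_iota; congr (map _ (iota _ _)); lia.
have t0 : (0 < strank (initseg y i.+1))%N by apply: strank_gt0; rewrite size_mkseq.
have := bin_take i.+1 (initseg y n); rewrite ti -!succ_strank ltnS => le_y.
by rewrite !nth_initseg //; lia.
Qed.

(** * The test *)

(* Subtracting the leading binary digit leaves each number as the index of
   infinitely many lengths. *)
Definition description_index (L : nat) : nat := (L - 2 ^ trunc_log 2 L)%N.

Lemma description_index_inf k m :
  exists2 L, (m <= L)%N & description_index L = k.
Proof.
have lt_pow : (k + m < 2 ^ (k + m))%N by exact: ltn_expl.
(* As [k < 2 ^ (k + m)], the leading binary digit of this number is [2 ^ (k + m)], and [k]
   remains. *)
exists (2 ^ (k + m) + k)%N; first by lia.
rewrite /description_index (trunc_log_eq (n := k + m)) ?addKn //.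
by rewrite expnS; apply/andP; split; lia.
Qed.

(* Letting the length of t determine s spares the dovetailing over all
   descriptions, and leaves the generated open set unchanged. *)
Definition compressed_test (U : str -> option str) (c : nat) : set str :=
  [set t | exists s r y, [/\ strank s = description_index (size t),
     U s = Some r, (2 ^ (size s + c + 2) <= (size r).+1)%N & sends t y r]].

Lemma tc_rank_size e :
  total_computable e -> total_computable (fun v => rank_size (e v)).
Proof. by move=> te; apply: tc_log; apply: tc_succ. Qed.

Lemma tc_rank_prefix j e : total_computable j ->
  total_computable e -> total_computable (fun v => rank_prefix (j v) (e v)).
Proof.
move=> tj te; apply: (tc_iter half) => //; last exact: tc_succ.
by apply: tc_half; exact: tc_proj.
Qed.

Lemma tc_description_index e :
  total_computable e -> total_computable (fun v => description_index (e v)).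
Proof.
by move=> te; apply: tc_sub => //; apply: tc_exp2; apply: tc_log.
Qed.

(** Entry 0 is the candidate y of a search, entry 1 is kept for the level of the test, entries 2 and
    3 are the test string and the output of the machine. Under the quantifier all positions move up
    by one. *)
Lemma tc_sends_rank :
  total_computable (fun v => sends_rank (nth 0 v 2) (nth 0 v 0) (nth 0 v 3))%N.
Proof.
have tp := tc_proj; apply: tc_and; first by apply: tc_eq; apply: tc_rank_size.
apply: tc_and; first by apply: tc_leq => //; apply: tc_rank_size.
have E v i : nth 0%N (behead v) i = nth 0%N v i.+1 by rewrite nth_behead.
apply: (tc_all (fun v => rank_size (nth 0%N v 3)) (fun j v =>
  odd (rank_prefix ((rank_size (nth 0%N v 2)).+1 - rank_prefix j (nth 0%N v 0))
    (nth 0%N v 2)) == odd (rank_prefix j (nth 0%N v 3)))).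
- exact: tc_rank_size.
- apply: (@tc_ext (fun v =>
    odd (rank_prefix ((rank_size (nth 0%N v 3)).+1
      - rank_prefix (nth 0%N v 0) (nth 0%N v 1)) (nth 0%N v 3))
    == odd (rank_prefix (nth 0%N v 0) (nth 0%N v 4)))).
    by move=> v; rewrite !E -nth0.
  apply: tc_eqb; apply: tc_odd; apply: tc_rank_prefix => //.
  apply: tc_sub; last exact: tc_rank_prefix.
  by apply: tc_succ; exact: tc_rank_size.
- apply: (@tc_ext (fun v => rank_size (nth 0%N v 4))).
    by move=> v; rewrite E.
  exact: tc_rank_size.
Qed.

(** To accept t at level c: read off the description s from the length of t, run the program of [U]
    on s, then search for an input prefix y that passes the decidable check [D]. Rejection is
    divergence of either stage. *)
Lemma uniformly_ce_compressed_test U :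
  partial_computable U -> uniformly_ce (compressed_test U).
Proof.
move=> [u uE].
pose D v := (2 ^ (rank_size (description_index (rank_size (nth 0 v 2)))
    + nth 0 v 1 + 2) <= (rank_size (nth 0 v 3)).+1)%N &&
  sends_rank (nth 0%N v 2) (nth 0%N v 0) (nth 0%N v 3).
have [d dE] : total_computable (fun v => ~~ D v).
  apply: tc_negb; apply: tc_and; last exact: tc_sends_rank.
  have tp := tc_proj; apply: tc_leq; last by apply: tc_succ; exact: tc_rank_size.
  apply: tc_exp2; apply: tc_add; last exact: tc_const.
  apply: tc_add => //; apply: tc_rank_size; apply: tc_description_index.
  exact: tc_rank_size.
have [i iE] : total_computable
    (fun v => description_index (rank_size (nth 0%N v 1))).
  by apply: tc_description_index; apply: tc_rank_size; exact: tc_proj.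
exists (Comp (Mu d) [:: Proj 0; Proj 1; Comp u [:: i]]) => c t; split.
  move=> [s [r [y [sE Us le_r ty]]]].
  have ex : exists y, D [:: y; c; strank t; strank r].
    exists (strank y); rewrite /D /= sends_rankE ty andbT !rank_size_strank.
    by rewrite -sE rank_size_strank.
  exists (ex_minn ex), [:: c; strank t; strank r].
    split=> //; split=> //; split=> //; exists [:: strank s].
      split=> //; have := iE [:: c; strank t].
      by rewrite /= rank_size_strank -sE.
    by apply/uE; exists r.
  case: ex_minnP => m Dm min_m; split.
    by have := dE [:: m; c; strank t; strank r]; rewrite Dm.
  move=> k lt_k; exists 0%N; have := dE [:: k; c; strank t; strank r].
  by case: (boolP (D _)) => // /min_m; rewrite leqNgt lt_k.
move=> [m [w]]; case: w => [|c' [|t' [|r' [|? ?]]]] /=; try tauto.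
move=> [-> [-> [+ _]]] [dm _].
move=> [[|s' [|? ?]]] /=; try tauto.
move=> [si _]; have := computes_fun si (iE _); rewrite /= => {si}->.
rewrite rank_size_strank; have [s sE] := strank_surj (description_index (size t)).
rewrite -sE => /uE [r Us rE]; move: dm; rewrite rE => dm.
have := computes_fun dm (dE _); case: (boolP (D _)) => // + _.
have [y <-] := strank_surj m.
rewrite /D /= sends_rankE !rank_size_strank -sE rank_size_strank.
by move=> /andP[le_r ty]; exists s, r, y.
Qed.

(** * Independence and the hitting probabilities *)

(** Expresses that membership in [A] does not depend on bit [i]. *)
Definition flip_invariant (i : nat) (A : set cantor) : Prop :=
  flip (pred1 i) @^-1` A = A.

Definition reindex (h : nat -> nat) (z : cantor) : cantor := fun n => z (h n).

Lemma reindex_flip h i z : injective h ->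
  reindex h (flip (pred1 (h i)) z) = flip (pred1 i) (reindex h z).
Proof.
by move=> h_inj; apply/funext => n; rewrite /reindex /flip /= (inj_eq h_inj).
Qed.

Lemma measurable_coord i b : measurable ([set z : cantor | z i = b]).
Proof.
pose F s := if size s == i then cylinder (rcons s b) else set0.
rewrite (_ : [set _ | _] = \bigcup_s F s).
  apply: countable_bigcupT_measurable => [|s]; first exact: countableP.
  rewrite /F.
  by case: ifP => _; [exact: measurable_cylinder|exact: measurable0].
apply/seteqP; split => [z zi|z [s _]]; rewrite /F; last first.
  by case: eqP => // <-; rewrite cylinder_rcons => -[].
exists (initseg z i); rewrite // size_mkseq eqxx cylinder_rcons size_mkseq.
by split=> //; rewrite /cylinder /= size_mkseq.
Qed.

Lemma measurable_reindex h : measurable_fun setT (reindex h).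
Proof.
apply: (@measurability _ _ cantor cantor setT _ (range cylinder)) => //.
move=> _ [_ [s _ <-] <-]; rewrite setTI; elim/last_ind: s => [|s b IH].
  by rewrite cylinder0 preimage_setT.
rewrite cylinder_rcons preimage_setI; apply: measurableI => //.
exact: measurable_coord.
Qed.

Lemma measurable_preimage_reindex h (A : set cantor) :
  measurable A -> measurable (reindex h @^-1` A).
Proof.
by move=> mA; rewrite -[X in measurable X]setTI; exact: measurable_reindex.
Qed.

Section Uniform.
Context {R : realType}.
Local Notation mu := (uniform R).

(** Flipping bit [i] preserves both the measure and [A], and exchanges the two halves of [A]. *)
Lemma uniform_coord i b (A : set cantor) : measurable A -> flip_invariant i A ->
  mu (A `&` [set z : cantor | z i = b]) = (2^-1%:E * mu A)%E.
Proof.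
move=> mA invA; pose B c := A `&` [set z : cantor | z i = c].
have mB c : measurable (B c) by apply: measurableI => //; exact: measurable_coord.
have flipB : mu (B b) = mu (B (~~ b)).
  rewrite -(uniform_flip R (pred1 i) (mB b)); congr (mu _).
  rewrite /B preimage_setI invA; congr (_ `&` _).
  by apply/seteqP; split=> z; rewrite /flip /= eqxx; case: (z i); case: b {mB}.
have AE : mu A = (mu (B b) + mu (B (~~ b)))%E.
  rewrite -measureU //.
    rewrite /B -setIUr [X in _ `&` X](_ : _ = setT) ?setIT //.
    by apply/seteqP; split => z //= _; case: (z i); case: b {flipB}; auto.
  by apply/seteqP; split => z //; rewrite /B /= => -[[_ ->] [_]]; case: b {flipB}.
rewrite -/(B b) AE -flipB.
rewrite -(fineK (fin_num_measure mu (B b) (mB b))).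
by rewrite -EFinD -EFinM; congr EFin; lra.
Qed.

Lemma uniform_mix (nu : {measure set cantor -> \bar R}) (k : R) : 0 <= k ->
  (forall s, nu (cylinder s) = (2 ^- size s * k)%:E) ->
  forall A, measurable A -> nu A = (mu A * k%:E)%E.
Proof.
move=> k0 nuE A mA; have mufin := fin_num_measure mu A mA.
(* For [k = 0] the measure cannot be normalised, but then the whole space is null. *)
have [k_eq0|k_neq0] := eqVneq k 0.
  rewrite k_eq0 mule0; apply: (@subset_measure0 _ _ _ nu A setT) => //.
  by have := nuE [::]; rewrite cylinder0 k_eq0 mulr0.
pose r : {nonneg R} := NngNum (etrans (invr_ge0 k) k0).
rewrite -(uniform_unique (mu := mscale r nu)) // => [|s].
  rewrite /= /mscale /= muleC muleA -EFinM mulfV // mul1e.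
  by [].
by rewrite /= /mscale nuE -EFinM /= mulrCA mulVf ?mulr1.
Qed.

(** Independence of [B] from the bits in the range of [h]. On cylinders each prescribed bit halves
    the measure, by [uniform_coord]; so the law of [reindex h] restricted to [B] is [mu B] times the
    uniform measure, by [uniform_mix]. *)
Lemma uniform_reindexI h (A B : set cantor) : injective h ->
  measurable A -> measurable B -> (forall i, flip_invariant (h i) B) ->
  mu (reindex h @^-1` A `&` B) = (mu A * mu B)%E.
Proof.
move=> h_inj mA mB invB; have mufin := fin_num_measure mu B mB.
have mh := measurable_reindex h.
have E s : mu (reindex h @^-1` cylinder s `&` B) = ((2 ^- size s)%:E * mu B)%E.
  have mC s' : measurable (reindex h @^-1` cylinder s' `&` B).
    apply: measurableI => //; apply: measurable_preimage_reindex.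
    exact: measurable_cylinder.
  elim/last_ind: s => [|s b IH].
    by rewrite cylinder0 preimage_setT setTI expr0 invr1 mul1e.
  rewrite cylinder_rcons preimage_setI setIAC.
  rewrite (_ : reindex h @^-1` [set x | x (size s) = b] =
    [set z : cantor | z (h (size s)) = b]) //.
  rewrite uniform_coord //.
    by rewrite [X in (_ * X)%E]IH muleA -EFinM size_rcons exprS invfM.
  rewrite /flip_invariant preimage_setI invB; congr (_ `&` _).
  rewrite -comp_preimage.
  apply/seteqP; split => z; rewrite /preimage /= reindex_flip // => /cylinderP zs;
    apply/cylinderP => i lt_i; move: (zs i lt_i); by rewrite /flip /= ltn_eqF // addbF.
pose hm : {mfun cantor >-> cantor} :=
  HB.pack (reindex h) (@isMeasurableFun.Build _ _ cantor cantor _ mh).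
rewrite -[in RHS](fineK mufin).
apply: (uniform_mix (pushforward (mrestr mu mB) hm)) => // [|s].
  by apply: fine_ge0; exact: measure_ge0.
by rewrite EFinM fineK //; exact: E.
Qed.
Lemma uniform_reindex h (A : set cantor) : injective h ->
  measurable A -> mu (reindex h @^-1` A) = mu A.
Proof.
move=> h_inj mA; rewrite -[X in mu X]setIT uniform_reindexI //.
by rewrite probability_setT mule1.
Qed.

End Uniform.

Lemma flip_invariant_reindex h i A : (forall n, h n != i) ->
  flip_invariant i (reindex h @^-1` A).
Proof.
move=> hi; rewrite /flip_invariant -comp_preimage; congr (_ @^-1` A).
apply/funext => z; apply/funext => n.
by rewrite /reindex /flip /= (negbTE (hi n)) addbF.
Qed.

(** * Splitting a code along the first input bit *)

Definition strunrank (k : nat) : str := xget [::] [set s | strank s = k].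

Lemma strunrankK : cancel strunrank strank.
Proof. by move=> k; exact: xgetPex (strank_surj k). Qed.

Lemma strankK : cancel strank strunrank.
Proof. by move=> s; apply: strank_inj; rewrite strunrankK. Qed.

(* The cell holding the value of f_z at b :: s, where s has rank k. *)
Definition subtree (b : bool) (k : nat) : nat := (strank (b :: strunrank k)).-1.

Lemma strank_cons_gt0 b s : (0 < strank (b :: s))%N.
Proof. by rewrite lt0n; apply/eqP => e; have := @strank_inj _ [::] e. Qed.

Lemma subtree_eq b c j k : subtree b j = subtree c k -> b = c /\ j = k.
Proof.
move=> e; have : strank (b :: strunrank j) = strank (c :: strunrank k).
  by rewrite -[LHS]prednK ?strank_cons_gt0 // -[RHS]prednK ?strank_cons_gt0 //;
    congr succn.
by move=> /strank_inj [-> /(can_inj strunrankK)].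
Qed.

Lemma subtree_inj b : injective (subtree b).
Proof. by move=> j k /subtree_eq []. Qed.

Lemma reindex_subtree b z s : reindex (subtree b) z (strank s) =
  z (strank (b :: s)).-1.
Proof. by rewrite /reindex /subtree strankK. Qed.

(** Here z lists the values of a function on the strings starting with a bit b: bit 0 is the value
    at [b], and the shift by one codes the function that continues after b. The event says that b
    outputs 0 and that n further zeros can follow. *)
Definition zero_step_hits (n : nat) : set cantor :=
  reindex succn @^-1` hits (nseq n false) `&` [set z | z 0%N = false].

Lemma hits_zeroE n z : hits (nseq n false) z <->
  exists y : cantor, forall i, (i < n)%N -> z (strank (initseg y i.+1)).-1 = false.
Proof.
split=> [[_ [[y _ <-] /cylinderP zy]]|[y zy]].
  exists y => i lt_i; have := zy i.
  by rewrite size_nseq nth_nseq lt_i => /(_ isT).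
exists (online z y); split; first by exists y.
by apply/cylinderP => i; rewrite size_nseq => lt_i; rewrite nth_nseq lt_i; exact: zy.
Qed.

Lemma initseg_cons y i : initseg y i.+1 = y 0%N :: initseg (y \o succn) i.
Proof. by rewrite /initseg /mkseq /= -[1%N]addn0 iotaDl -map_comp. Qed.

Lemma hits_zeroS n : hits (nseq n.+1 false) =
  reindex (subtree false) @^-1` zero_step_hits n `|`
  reindex (subtree true) @^-1` zero_step_hits n.
Proof.
have step b z : (reindex (subtree b) @^-1` zero_step_hits n) z <->
    exists2 y : cantor, y 0%N = b &
      forall i, (i < n.+1)%N -> z (strank (initseg y i.+1)).-1 = false.
  have E (y : cantor) i : reindex succn (reindex (subtree b) z)
      (strank (initseg y i.+1)).-1 = z (strank (b :: initseg y i.+1)).-1.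
    by rewrite -reindex_subtree {1}/reindex prednK // initseg_cons strank_cons_gt0.
  have E0 : reindex (subtree b) z 0%N = z (strank [:: b]).-1.
    exact: (reindex_subtree b z [::]).
  split=> [[/hits_zeroE [y zy] z0]|[y yb zy]].
    exists (fun i => if i is j.+1 then y j else b) => // i.
    rewrite ltnS initseg_cons /=; case: i => [_|i lt_i]; first by rewrite -E0.
    by rewrite -(zy i lt_i) E.
  split; last by have := zy 0%N isT; rewrite initseg_cons yb -E0.
  apply/hits_zeroE; exists (y \o succn) => i lt_i.
  by rewrite E -yb -initseg_cons zy.
apply/seteqP; split => z.
  move=> /hits_zeroE [y zy].
  by case y0 : (y 0%N); [right|left]; apply/step; exists y.
by case=> /step [y _ zy]; apply/hits_zeroE; exists y.
Qed.

Section HittingProb.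
Context {R : realType}.
Local Notation mu := (uniform R).
Local Notation p := (hitting_prob R).

Lemma measurable_zero_step_hits n : measurable (zero_step_hits n).
Proof.
apply: measurableI; last exact: measurable_coord.
by apply: measurable_preimage_reindex; exact: measurable_hits.
Qed.

Lemma uniform_zero_step_hits n : mu (zero_step_hits n) = (2^-1 * p n)%:E.
Proof.
have mH := measurable_hits (nseq n false).
rewrite uniform_coord //; first last.
- exact: flip_invariant_reindex.
- exact: measurable_preimage_reindex.
by rewrite uniform_reindex ?hits_size ?size_nseq //; exact: succn_inj.
Qed.

Lemma hitting_prob0 : p 0 = 1.
Proof.
rewrite /hitting_prob (_ : hits _ = setT) ?probability_setT //.
by apply/seteqP; split => // z _; apply/hits_zeroE; exists (fun=> false).
Qed.

(** The two events of [hits_zeroS] have probability [p n / 2] each and are independent, as they read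
    disjoint sets of bits; inclusion-exclusion concludes. *)
Lemma hitting_probS n : p n.+1 = p n * (1 - p n / 4).
Proof.
have mZ := measurable_zero_step_hits n.
have mS b : measurable (reindex (subtree b) @^-1` zero_step_hits n).
  exact: measurable_preimage_reindex.
have muS b : mu (reindex (subtree b) @^-1` zero_step_hits n) = (2^-1 * p n)%:E.
  by rewrite uniform_reindex ?uniform_zero_step_hits //; exact: subtree_inj.
have muI : mu (reindex (subtree false) @^-1` zero_step_hits n `&`
    reindex (subtree true) @^-1` zero_step_hits n) =
    ((2^-1 * p n)%:E * (2^-1 * p n)%:E)%E.
  rewrite uniform_reindexI //; first last.
  - move=> i; apply: flip_invariant_reindex => j.
    by apply/eqP => /subtree_eq [].
  - exact: subtree_inj.
  by congr (_ * _)%E; [exact: uniform_zero_step_hits|exact: muS].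
apply: EFin_inj; have := hits_size R (nseq n.+1 false).
rewrite size_nseq => <-; rewrite hits_zeroS measureUfinl //; last first.
  by have := muS false; rewrite /= => ->; exact: ltry.
rewrite [X in (X + _ - _)%E](muS false) [X in (_ + X - _)%E](muS true).
rewrite [X in (_ - X)%E]muI.
by rewrite -EFinM -EFinD; congr EFin; lra.
Qed.

(** In terms of reciprocals, 1/p_(n+1) - 1/p_n = 1/(4 - p_n) lies between 1/4 and 1 because 0 < p_n
    <= 1. The induction does this with denominators cleared. *)
Lemma hitting_prob_bounds n : n.+1%:R^-1 <= p n <= 4 / n.+4%:R.
Proof.
elim: n => [|n /andP[lo hi]]; first by rewrite hitting_prob0 invr1 divff ?lexx.
rewrite hitting_probS; set q := p n in lo hi *.
have n0 : 0 <= n%:R :> R by exact: ler0n.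
have eS k : (n + k)%:R = n%:R + k%:R :> R by rewrite natrD.
rewrite -[n.+1]addn1 eS in lo; rewrite -[n.+4]addn4 eS in hi.
have [-> ->] : n.+2 = (n + 2)%N /\ n.+1.+4 = (n + 5)%N by lia.
rewrite !eS.
have q1 : q <= 1.
  by apply: (le_trans hi); rewrite ler_pdivrMr; lra.
have {lo} : 1 <= q * (n%:R + 1).
  by move: lo; rewrite -[_^-1]mul1r ler_pdivrMr //; lra.
have {hi} : q * (n%:R + 4) <= 4 by move: hi; rewrite ler_pdivlMr //; lra.
move: (n%:R : R) n0 => m m0 hi lo.
rewrite -[(m + 2)^-1]mul1r ler_pdivrMr ?ler_pdivlMr; try lra.
apply/andP; split; nra.
Qed.

End HittingProb.

(** * Incompressibility *)

Lemma measurable_open_of A : measurable (open_of A).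
Proof.
rewrite /open_of bigcup_mkcond.
apply: countable_bigcupT_measurable => [|s]; first exact: countableP.
by case: ifP => _; [exact: measurable_cylinder|exact: measurable0].
Qed.

Lemma prefix_cylinder s t z :
  cylinder s z -> cylinder t z -> seq.prefix s t \/ seq.prefix t s.
Proof.
move=> zs zt; wlog le_st : s t zs zt / (size s <= size t)%N => [H|].
  by case/orP: (leq_total (size s) (size t)) => /H; [apply|case=> //; auto].
left; rewrite prefixE; apply/eqP; rewrite -zs -zt.
by rewrite /initseg /mkseq -map_take take_iota; congr (map _ (iota _ _));
  rewrite size_map size_iota; lia.
Qed.

Section Main.
Context {R : realType} (U : str -> option str).
Local Notation mu := (uniform R).
Local Notation p := (hitting_prob R).

(** Kraft's inequality in measure form: the sets [G k], cylinders of descriptions, are disjoint by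
    prefix-freeness, so their measures sum to at most 1, and [F k] has measure at most [2 ^- c]
    times that of [G k]. *)
Lemma ml_test_compressed : prefix_free_machine U ->
  ml_test R (compressed_test U).
Proof.
move=> [U_pc U_pf]; split=> [|c]; first exact: uniformly_ce_compressed_test.
pose G k : set cantor := if U (strunrank k) is Some _ then cylinder (strunrank k) else set0.
pose F k := if U (strunrank k) is Some r then
  if (2 ^ (size (strunrank k) + c + 2) <= (size r).+1)%N then hits r else set0
  else set0.
have mG k : measurable (G k).
  by rewrite /G; case: (U _) => *; [exact: measurable_cylinder|exact: measurable0].
have mF k : measurable (F k).
  rewrite /F; case: (U _) => [r|]; last exact: measurable0.
  by case: ifP => _; [exact: measurable_hits|exact: measurable0].
have FG k : (mu (F k) <= (2 ^- c)%:E * mu (G k))%E.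
  rewrite /F /G; case: (U _) => [r|]; last by rewrite measure0 mule0.
  case: ifP => [le_r|_]; last by rewrite measure0 mule_ge0 // lee_fin invr_ge0 exprn_ge0.
  rewrite hits_size uniform_cylinder -EFinM lee_fin.
  have /andP[_ /le_trans] := hitting_prob_bounds (R := R) (size r); apply.
  move: (size r) le_r => n; rewrite -(ler_nat R) natrX !exprD expr2.
  (* The summand 2 in the exponent gives [4 * a * b <= n + 1], which absorbs the 4 of the upper
     bound on the hitting probability. *)
  set a := 2 ^+ size _; set b := 2 ^+ c.
  have a0 : 0 < a by exact: exprn_gt0.
  have b0 : 0 < b by exact: exprn_gt0.
  have -> : n.+4 = (n.+1 + 3)%N by lia.
  rewrite natrD -invfM; move: (n.+1%:R : R) (ler0n R n.+1) => m m0 le_m.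
  rewrite ler_pdivrMr; last by lra.
  rewrite [leRHS]mulrC ler_pdivlMr; last exact: mulr_gt0.
  lra.
have GI : trivIset setT G.
  apply/trivIsetP => j k _ _ njk; apply/seteqP; split => // z; rewrite /G.
  case Uj: (U (strunrank j)) => [rj|]; case Uk: (U (strunrank k)) => [rk|];
    try by case.
  have nj : U (strunrank j) <> None by rewrite Uj.
  have nk : U (strunrank k) <> None by rewrite Uk.
  move=> [/prefix_cylinder zj /zj {zj}].
  case=> [/(U_pf _ _ nj nk)|/(U_pf _ _ nk nj)] /(can_inj strunrankK) ejk;
    by move: njk; rewrite ejk eqxx.
have sub : open_of (compressed_test U c) `<=` \bigcup_k F k.
  move=> z [t [s [r [y [sE Us le_r ty]]]] zt].
  exists (strank s) => //; rewrite /F strankK Us le_r.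
  exact: sends_hits ty z zt.
apply: (le_trans (measure_sigma_subadditive mu mF (measurable_open_of _) sub)).
apply: (le_trans (lee_nneseries _ (fun k _ => FG k))) => //.
rewrite nneseriesZl //.
have mUG : measurable (\bigcup_k G k) by exact: bigcup_measurable.
rewrite -measure_semi_bigcup //.
by rewrite -[leRHS]mule1 lee_wpmul2l ?probability_le1 // lee_fin invr_ge0 exprn_ge0.
Qed.

Lemma random_online_incompressible x : prefix_free_machine U ->
  (exists z, ml_random R z /\ range (online z) x) ->
  exists c, forall s n, U s = Some (initseg x n) ->
    (n.+1 < 2 ^ (size s + c))%N.
Proof.
move=> U_pf [z [z_random [y _ <-]]].
have /existsNP [c zc] : ~ forall c, open_of (compressed_test U c) z.
  by move=> H; apply: (z_random _ (ml_test_compressed U_pf)) => c _.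
exists (c + 2)%N => s n Us; rewrite ltnNge; apply/negP => le_n; apply: zc.
(* A length that encodes [s] and is large enough for the initial segment of [z] to contain every bit
   used in computing the first [n] outputs. *)
have [L le_L LE] := description_index_inf (strank s) (strank (initseg y n)).
exists (initseg z L); last by rewrite /cylinder /= size_mkseq.
exists s, (initseg (online z y) n), (initseg y n); split=> //.
- by rewrite size_mkseq.
- by rewrite size_mkseq -addnA.
- exact: sends_initseg.
Qed.

End Main.

Theorem corollary5p7 (R : realType) (U : seq bool -> option (seq bool))
    (U_optimal : optimal_machine U) (x : cantor)
    (x_range : exists z, ml_random R z /\ range (online z) x) :
  (exists c : nat, forall n : nat,
     ((- log2 (hitting_prob R n) - c%:R)%:E <= K R U (initseg x n))%E) /\
  complex R U x.
Proof.
have [c xc] := random_online_incompressible U x (proj1 U_optimal) x_range.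
split.
  (* Every description s satisfies -log p_n <= log (n + 1) <= |s| + c. *)
  exists c => n; apply: le_ereal_inf_tmp => _ [s /= Us <-]; rewrite lee_fin.
  have /andP[lo _] := hitting_prob_bounds (R := R) n.
  have ln2 : 0 < ln 2 :> R by rewrite ln_gt0 // ltr1n.
  have p0 : 0 < hitting_prob R n by apply: lt_le_trans lo; rewrite invr_gt0.
  rewrite lerBlDr -natrD /log2 -mulNr ler_pdivrMr // -ln_powR powR_mulrn //.
  rewrite -lnV ?posrE // ler_ln ?posrE ?invr_gt0 ?exprn_gt0 //.
  have /ltnW := xc s n Us; rewrite -(ler_nat R) natrX; apply: le_trans.
  by rewrite invf_ple ?posrE.
(* The integer part of log (n + 1), lowered by [c]; truncated subtraction makes it 0 where it would
   be negative. *)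
exists (fun n => trunc_log 2 n.+1 - c)%N; split.
- have [d dE] : total_computable (fun v => trunc_log 2 (nth 0 v 0).+1 - c)%N.
    apply: tc_sub; last exact: tc_const.
    by apply: tc_log; apply: tc_succ; exact: tc_proj.
  by exists d => n; exact: (dE [:: n]).
- split=> [m n le_mn|k]; first by apply: leq_sub2r; apply: leq_trunc_log.
  have H : (k + c <= trunc_log 2 (2 ^ (k + c)).+1)%N by exact: trunc_log_max.
  by exists (2 ^ (k + c))%N; lia.
- move=> n; apply: le_ereal_inf_tmp => _ [s /= Us <-]; rewrite lee_fin ler_nat.
  rewrite leq_subLR addnC; apply: ltnW.
  rewrite -(ltn_exp2l _ _ (isT : 1 < 2)%N).
  by apply: leq_ltn_trans (xc s n Us); exact: trunc_logP.
Qed.
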